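(* Let $n\ge 1$ and $m\ge 2$. For metric sequential transportation games with $n$ players and $m$ buses, $\mathrm{SPoS}(E)\ge\lfloor n/m\rfloor$, even when restricted to games in which all buses have the same permutation. That is, if $\mathcal{G}$ is the class of metric sequential transportation games with $n$ players and $m$ buses in which $\pi_1=\dots=\pi_m$, then $\mathrm{SPoS}(E,\mathcal{G})\ge\lfloor n/m\rfloor$.
   Context: Transportation game. An instance $\Gamma$ consists of a set of players $N=\{1,\dots,n\}$ ($n\ge 1$), a set of buses $M=\{1,\dots,m\}$ with $m\ge 2$, a complete undirected graph on the vertex set $V=N\cup\{s,t\}$ ($s$ the source, $t$ the destination) with a distance function $d$ assigning a nonnegative real $d(x,y)=d(y,x)$ to each edge (with $d(x,x)=0$), and for each bus $j\in M$ a permutation $\pi_j$ of $N$. The instance is metric if $d(x,w)\le d(x,y)+d(y,w)$ for all $x,y,w\in V$. Distances between distinct vertices may be $0$. An outcome is a map $\sigma:N\to M$, $\sigma_i$ being the bus chosen by player $i$; $\mathcal{P}$ is the set of outcomes. Given $\sigma$, bus $j$ starts at $s$, visits exactly the players $i$ with $\sigma_i=j$, in the order in which they appear in $\pi_j$, and ends at $t$. Let $n_j=|\{i:\sigma_i=j\}|$, let $p^j_i$ be the $i$-th player visited by bus $j$, and put $p^j_{n_j+1}=t$. The cost of the player $p^j_k$ is $c_{p^j_k}(\sigma)=\sum_{l=k}^{n_j} d(p^j_l,p^j_{l+1})$, the distance travelled by her bus from her location to $t$. The egalitarian social cost function is $E(\sigma)=\max_{i\in N}c_i(\sigma)$. Sequential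 version. Players choose buses in the order $1,2,\dots,n$, each observing all earlier choices. A strategy of player $i$ is a function $\lambda_i$ assigning a bus to each possible history $\sigma_{<i}=(\sigma_1,\dots,\sigma_{i-1})\in M^{i-1}$; a strategy profile is $\lambda=(\lambda_1,\dots,\lambda_n)$. Its outcome is the $\sigma$ with $\sigma_i=\lambda_i(\sigma_{<i})$ for all $i$. A strategy profile $\lambda$ is a subgame perfect equilibrium (SPE) if for every player $i$ and every history $\sigma_{<i}$, player $i$ cannot decrease her cost by choosing a bus other than $\lambda_i(\sigma_{<i})$ after the history $\sigma_{<i}$, when players $i+1,\dots,n$ then play according to $\lambda_{i+1},\dots,\lambda_n$. An SPE always exists. For a social cost function $f$, $f(\lambda)$ denotes $f$ of the outcome of $\lambda$. With $\sigma^*\in\mathcal{P}$ minimizing $f$, $\mathrm{SPoS}(f,\Gamma)=\min_{\lambda\in \mathrm{SPE}(\Gamma)} f(\lambda)/f(\sigma^* )$, and for a class $\mathcal{G}$ of games $\mathrm{SPoS}(f,\mathcal{G})=\sup_{\Gamma\in\mathcal{G}}\mathrm{SPoS}(f,\Gamma)$, the supremum being over the $\Gamma\in\mathcal{G}$ with $f(\sigma^* )>0$. *)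

(* Defs.v *)
From HB Require Import structures.
From mathcomp Require Import all_boot all_order all_algebra all_fingroup.
From mathcomp Require Import all_classical all_reals ereal.

Set Implicit Arguments.
Unset Strict Implicit.
Unset Printing Implicit Defensive.

Import Order.TTheory GRing.Theory Num.Theory.
Local Open Scope classical_set_scope.
Local Open Scope ring_scope.

(* Players, buses and positions are numbered from 0: N = 'I_n, M = 'I_m. *)
Inductive vertex (n : nat) : Type :=
  | player of 'I_n
  | source
  | destination.
Arguments source {n}.
Arguments destination {n}.

Record game (R : realType) (n m : nat) := Game {
  dist : vertex n -> vertex n -> R;
  (* [order j k] is the player in position [k] of the permutation of bus [j] *)
  order : 'I_m -> {perm 'I_n};
  dist_ge0 : forall x y, 0 <= dist x y;
  dist_sym : forall x y, dist x y = dist y x;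
  dist_xx : forall x, dist x x = 0
}.

Definition metric (R : realType) (n m : nat) (G : game R n m) : Prop :=
  forall x y w, dist G x w <= dist G x y + dist G y w.

Definition same_permutation (R : realType) (n m : nat) (G : game R n m) : Prop :=
  forall j k : 'I_m, order G j = order G k.

Definition outcome (n m : nat) : Type := {ffun 'I_n -> 'I_m}.

Definition passengers (R : realType) (n m : nat) (G : game R n m)
    (sigma : outcome n m) (j : 'I_m) : seq 'I_n :=
  [seq i <- [seq order G j k | k <- enum 'I_n] | sigma i == j].

(* The l-th stop of bus j; past the last passenger it is the destination. *)
Definition stop (R : realType) (n m : nat) (G : game R n m)
    (sigma : outcome n m) (j : 'I_m) (l : nat) : vertex n :=
  nth destination [seq player i | i <- passengers G sigma j] l.

Definition cost (R : realType) (n m : nat) (G : game R n m)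
    (sigma : outcome n m) (i : 'I_n) : R :=
  let j := sigma i in
  let p := passengers G sigma j in
  \sum_(index i p <= l < size p)
     dist G (stop G sigma j l) (stop G sigma j l.+1).

Definition social_cost (R : realType) (n m : nat) : Type :=
  game R n m -> outcome n m -> R.

(* Costs are nonnegative, so starting the maximum from 0 is harmless. *)
Definition egalitarian (R : realType) (n m : nat) : social_cost R n m :=
  fun G sigma => \big[Num.max/0]_(i < n) cost G sigma i.

(* Player i is preceded by exactly (i : nat) players. *)
Definition profile (n m : nat) : Type :=
  forall i : 'I_n, i.-tuple 'I_m -> 'I_m.

Fixpoint realized_history (n m : nat) (lambda : profile n m) (k : nat) :
    (k <= n)%N -> k.-tuple 'I_m :=
  match k with
  | 0 => fun _ => [tuple]
  | k'.+1 => fun lt_k'n =>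
      let h := realized_history lambda (ltnW lt_k'n) in
      [tuple of rcons h (lambda (Ordinal lt_k'n) h)]
  end.

Definition outcome_of (n m : nat) (lambda : profile n m) : outcome n m :=
  [ffun i : 'I_n => lambda i (realized_history lambda (ltnW (ltn_ord i)))].

(* The subgame after the history h and the choice j of player i is encoded by
   the profile in which the players up to i are forced to play h and j. *)
Definition outcome_after (n m : nat) (lambda : profile n m)
    (i : 'I_n) (h : i.-tuple 'I_m) (j : 'I_m) : outcome n m :=
  outcome_of (fun k hk => if (k < i)%N then nth j h k
                          else if k == i then j
                          else lambda k hk).

Definition SPE (R : realType) (n m : nat) (G : game R n m)
    (lambda : profile n m) : Prop :=
  forall (i : 'I_n) (h : i.-tuple 'I_m) (j : 'I_m),
    cost G (outcome_after lambda h (lambda i h)) i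
      <= cost G (outcome_after lambda h j) i.

(* For m >= 1, [optimum] and [SPoS] are minima: see [optimum_attained]
   and [SPoS_attained] below. *)
Definition optimum (R : realType) (n m : nat) (f : social_cost R n m)
    (G : game R n m) : R :=
  inf [set f G sigma | sigma in [set: outcome n m]].

Definition SPoS (R : realType) (n m : nat) (f : social_cost R n m)
    (G : game R n m) : R :=
  inf [set f G (outcome_of lambda) / optimum f G | lambda in SPE G].

Definition SPoS_class (R : realType) (n m : nat) (f : social_cost R n m)
    (C : set (game R n m)) : \bar R :=
  ereal_sup [set (SPoS f G)%:E | G in [set G | C G /\ 0 < optimum f G]].

(* The outcome of lambda is the sigma with sigma_i = lambda_i (sigma_{<i}). *)
Definition history (n m : nat) (sigma : outcome n m) (i : 'I_n) :
    i.-tuple 'I_m :=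
  [tuple sigma (widen_ord (ltnW (ltn_ord i)) k) | k < i].

Lemma nth_realized_history (n m : nat) (lambda : profile n m) (x0 : 'I_m)
    (k : nat) (le_kn : (k <= n)%N) (i : 'I_n) :
  (i < k)%N -> nth x0 (realized_history lambda le_kn) i = outcome_of lambda i.
Proof.
elim: k le_kn => // k IH lt_kn; rewrite ltnS leq_eqVlt nth_rcons size_tuple.
have [lt_ik _|_ /[!orbF] /eqP eq_ik] := ltnP i k; first exact: IH.
rewrite eq_ik eqxx ffunE.
have -> : i = Ordinal lt_kn by apply: val_inj.
rewrite /=; congr (lambda _ (realized_history _ _)); exact: bool_irrelevance.
Qed.

Lemma realized_historyE (n m : nat) (lambda : profile n m) (i : 'I_n) :
  realized_history lambda (ltnW (ltn_ord i)) = history (outcome_of lambda) i.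
Proof.
apply: eq_from_tnth => k; rewrite tnth_mktuple.
rewrite (tnth_nth (lambda i (history (outcome_of lambda) i))).
have lt_ki : (widen_ord (ltnW (ltn_ord i)) k < i)%N by exact: (ltn_ord k).
exact: nth_realized_history lt_ki.
Qed.

Lemma outcome_ofE (n m : nat) (lambda : profile n m) (i : 'I_n) :
  outcome_of lambda i = lambda i (history (outcome_of lambda) i).
Proof. by rewrite {1}ffunE realized_historyE. Qed.

Lemma outcome_of_unique (n m : nat) (lambda : profile n m) (sigma : outcome n m) :
  (forall i, sigma i = lambda i (history sigma i)) -> sigma = outcome_of lambda.
Proof.
move=> sE; apply/ffunP => i.
have [k] := ubnP (val i); elim: k i => // k IH i; rewrite ltnS => le_ik.
rewrite sE outcome_ofE; congr (lambda i _); apply: eq_from_tnth => l.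
by rewrite !tnth_mktuple; apply: IH; apply: leq_trans (ltn_ord l) le_ik.
Qed.

Lemma eq_outcome_after (n m : nat) (lambda mu : profile n m) (i : 'I_n)
    (h : i.-tuple 'I_m) (j : 'I_m) :
  (forall k : 'I_n, (i < k)%N -> lambda k = mu k) ->
  outcome_after lambda h j = outcome_after mu h j.
Proof.
move=> eq_lm; congr outcome_of.
apply: functional_extensionality_dep => k; apply: funext => hk.
case: ltnP => // le_ik; case: eqVneq => // ne_ki.
by rewrite eq_lm // ltn_neqAle le_ik andbT eq_sym.
Qed.

Lemma SPE_exists (R : realType) (n m : nat) (G : game R n m) :
  (0 < m)%N -> exists lambda, SPE G lambda.
Proof.
move=> m_gt0.
suff /(_ n)[lambda Hl] : forall r, exists lambda : profile n m,
    forall (i : 'I_n) (h : i.-tuple 'I_m) (j : 'I_m), (n - r <= i)%N ->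
    cost G (outcome_after lambda h (lambda i h)) i
      <= cost G (outcome_after lambda h j) i.
  by exists lambda => i h j; apply: Hl; rewrite subnn.
elim=> [|r [lambda Hl]].
  exists (fun _ _ => Ordinal m_gt0) => i h j.
  by rewrite subn0 leqNgt ltn_ord.
pose F (i : 'I_n) (h : i.-tuple 'I_m) j := cost G (outcome_after lambda h j) i.
pose mu : profile n m := fun i h => if (n - r <= i)%N then lambda i h
  else [arg min_(j < lambda i h) F i h j]%O.
exists mu => i h j; rewrite subnS -subn1 leq_subLR add1n => le_i.
have eq_after j' : outcome_after mu h j' = outcome_after lambda h j'.
  apply: eq_outcome_after => k lt_ik; apply: funext => hk; rewrite /mu ifT //.
  exact: leq_trans le_i lt_ik.
rewrite !eq_after /mu; case: ifP => [|_]; first exact: Hl.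
by case: arg_minP => // j' _; apply.
Qed.

Lemma inf_attained (R : realType) (T : finType) (F : T -> R) (P : set T) :
  P !=set0 -> exists2 x, P x & inf (F @` P) = F x.
Proof.
move=> [x0 Px0].
pose p : pred T := fun x => `[< P x >].
have px0 : p x0 by apply/asboolP.
case: (arg_minP F px0) => x /asboolP Px minx.
have lbx : lbound (F @` P) (F x) by move=> _ [y Py <-]; apply/minx/asboolP.
exists x => //; apply/le_anti/andP; split.
  by apply: ge_inf; [exists (F x) | exists x].
by apply: lb_le_inf => //; exists (F x); exists x.
Qed.

Lemma optimum_attained (R : realType) (n m : nat) (f : social_cost R n m)
    (G : game R n m) : (0 < m)%N ->
  exists2 sigma, optimum f G = f G sigma & forall tau, f G sigma <= f G tau.
Proof.
move=> m_gt0; pose sigma0 : outcome n m := [ffun=> Ordinal m_gt0].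
have [|sigma _ eq_opt] := @inf_attained R (outcome n m) (f G) setT.
  by exists sigma0.
exists sigma => // tau; rewrite -eq_opt; apply: ge_inf; last by exists tau.
case: (arg_minP (f G) (isT : predT sigma0)) => rho _ min_rho.
by exists (f G rho) => _ [y _ <-]; apply: min_rho.
Qed.

Lemma SPoS_attained (R : realType) (n m : nat) (f : social_cost R n m)
    (G : game R n m) : (0 < m)%N ->
  exists2 lambda, SPE G lambda
    & SPoS f G = f G (outcome_of lambda) / optimum f G.
Proof.
move=> m_gt0; pose F (sigma : outcome n m) := f G sigma / optimum f G.
have [lambda0 spe0] := SPE_exists G m_gt0.
have -> : SPoS f G = inf (F @` (@outcome_of n m @` SPE G)).
  by rewrite image_comp.
have [|_ [lambda spe <-] ->] := @inf_attained R _ F (@outcome_of n m @` SPE G).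
  by exists (outcome_of lambda0); exists lambda0.
by exists lambda.
Qed.

(* Main.v *)
(**
Let every bus visit the players in the order opposite to the one in which they
choose. The cost of a player then depends on earlier choices only, so in an SPE
every player greedily picks the bus on which the route from her to t is
shortest.

Cut the players into consecutive groups of m, and place the even groups in one
cluster and the odd groups in another one: distances are delta inside a
cluster, 2 between the clusters, and 1 from every player to t. Joining a member
of one's own group costs an extra delta > 0, so the m players of a group choose
distinct buses, and each of them continues to a player of the previous group,
in the other cluster; hence group g (from 0) pays exactly 2 g + 1. With one bus
per cluster, all costs are at most 1 + delta n. For q = n / m >= 2 and
delta = 1 / (2 n), the ratio is at least (2 q - 1) / (3 / 2) >= q; for q <= 1
the trivial bound SPoS >= 1 suffices.
*)
Require Import Defs.
From mathcomp Require Import all_boot all_order all_algebra all_fingroup.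
From mathcomp Require Import all_classical all_reals ereal.
From mathcomp Require Import zify lra.

Set Implicit Arguments.
Unset Strict Implicit.
Unset Printing Implicit Defensive.

Import Order.TTheory GRing.Theory Num.Theory.
Local Open Scope ring_scope.

(** * Costs as recursive route lengths *)

Section Tour.
Context {R : realType} {n m : nat} (G : game R n m).

Fixpoint tour (s : seq 'I_n) : R :=
  if s is i :: s' then
    dist G (player i) (head destination [seq player k | k <- s']) + tour s'
  else 0.

(** [cost] is a sum over positions on the bus; starting it at [size s1] skips the stops made before
    the player. *)
Lemma tourE (s1 s2 : seq 'I_n) :
  \sum_(size s1 <= l < size (s1 ++ s2))
     dist G (nth destination [seq player i | i <- s1 ++ s2] l)
            (nth destination [seq player i | i <- s1 ++ s2] l.+1) = tour s2.
Proof.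
rewrite -{1}[size s1]add0n big_addn size_cat addnC addnK map_cat.
under eq_bigr => l _.
  rewrite -addSn !nth_cat size_map !ltnNge !leq_addl !addnK /=; over.
elim: s2 => [|i s2 IH]; first by rewrite big_nil.
by rewrite big_nat_recl //= IH nth0.
Qed.

Definition descending_order := forall j k, Defs.order G j k = rev_ord k.

End Tour.

(** * Later stops under the descending order, and greedy play *)

Section Followers.
Context {n m : nat}.
Implicit Types (sigma tau : outcome n m) (i : 'I_n) (j : 'I_m).

(** In the descending order, [k = i] gives the stops that follow [i] if she takes bus [j]. A natural
    number [k] also allows [i.+1], which lets [i] herself in. *)
Definition followers sigma j (k : nat) : seq 'I_n :=
  [seq i : 'I_n <- [seq rev_ord l | l <- enum 'I_n] | (i < k)%N && (sigma i == j)].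

Lemma eq_followers sigma tau j (k : nat) :
  (forall i : 'I_n, (i < k)%N -> sigma i = tau i) ->
  followers sigma j k = followers tau j k.
Proof.
by move=> eq_st; apply: eq_filter => i; case: ltnP => //= /eq_st ->.
Qed.

Lemma size_followers sigma j (k : nat) : (size (followers sigma j k) <= n)%N.
Proof.
rewrite size_filter (leq_trans (count_size _ _)) //.
by rewrite size_map -cardE card_ord.
Qed.

(** The reversed enumeration is strictly decreasing, so [i] separates the larger players from the
    smaller ones. *)
Lemma rev_ord_split i : exists s1 s2, [/\
  [seq rev_ord l | l <- enum 'I_n] = s1 ++ i :: s2,
  all (fun k : 'I_n => i < k)%N s1 & all (fun k : 'I_n => k < i)%N s2].
Proof.
have srt : sorted (fun k l : 'I_n => l < k)%N [seq rev_ord l | l <- enum 'I_n].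
  rewrite sorted_map.
  have: sorted ltn (map val (enum 'I_n)) by rewrite val_enum_ord iota_ltn_sorted.
  rewrite sorted_map; apply: sub_sorted => k l /=.
  by have := ltn_ord k; have := ltn_ord l; lia.
have : i \in [seq rev_ord l | l <- enum 'I_n].
  by apply/mapP; exists (rev_ord i); rewrite ?mem_enum ?rev_ordK.
have tr : transitive (fun k l : 'I_n => l < k)%N.
  by move=> a b c /= ab bc; apply: ltn_trans bc ab.
move=> /path.splitPr iin; move: srt; case: iin => s1 s2 srt.
exists s1, s2; split=> //; move: srt; rewrite (sorted_pairwise tr).
- rewrite pairwise_cat => /and3P[+ _ _].
  by move=> /allrelP H; apply/allP => k ks; apply: H => //; rewrite mem_head.
- by rewrite pairwise_cat /= => /and4P[_ _ + _].
Qed.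

Lemma followersS sigma i : followers sigma (sigma i) i.+1 =
  i :: followers sigma (sigma i) i.
Proof.
have [s1 [s2 [e /allP gt1 /allP lt2]]] := rev_ord_split i.
rewrite /followers e !filter_cat /= ltnS leqnn ltnn eqxx /=.
have f0 (k : nat) : (k <= i.+1)%N ->
    [seq x : 'I_n <- s1 | (x < k)%N && (sigma x == sigma i)] = [::].
  move=> ki; rewrite -(filter_pred0 s1); apply: eq_in_filter => x /gt1 ix.
  by rewrite ltnNge (leq_trans ki ix).
rewrite !f0 //=; congr (_ :: _); apply: eq_in_filter => x /lt2 xi.
by rewrite xi ltnS ltnW.
Qed.

(** The stops after [i] are the passengers that chose before her, so later choices cannot affect her
    cost. *)
Lemma cost_tour (R : realType) (G : game R n m) sigma i :
  descending_order G ->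
  cost G sigma i = tour G (i :: followers sigma (sigma i) i).
Proof.
move=> desc; rewrite -followersS /cost /stop /passengers.
have -> : [seq Defs.order G (sigma i) k | k <- enum 'I_n] =
    [seq rev_ord k | k <- enum 'I_n] by apply: eq_map => k; rewrite desc.
have [s1 [s2 [e /allP gt1 /allP lt2]]] := rev_ord_split i.
rewrite followersS /followers e !filter_cat /= ltnn eqxx /=.
have -> : [seq x : 'I_n <- s1 | (x < i)%N && (sigma x == sigma i)] = [::].
  rewrite -(filter_pred0 s1); apply: eq_in_filter => x /gt1 ix.
  by rewrite ltnNge (ltnW ix).
have -> : [seq x : 'I_n <- s2 | (x < i)%N && (sigma x == sigma i)] =
    [seq x : 'I_n <- s2 | sigma x == sigma i].
  by apply: eq_in_filter => x /lt2 ->.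
rewrite index_cat mem_filter eqxx /= eqxx addn0 ifF; first exact: tourE.
by apply/negP => /gt1; rewrite ltnn.
Qed.

(** If bus [j] has an earlier passenger, the next stop is the largest one, [h], and the rest of the
    route is the one [h] pays for. This feeds the induction on players. *)
Lemma followersP sigma j (k : nat) :
  (forall i : 'I_n, (i < k)%N -> sigma i <> j) /\ followers sigma j k = [::] \/
  exists h : 'I_n, [/\ (h < k)%N, sigma h = j,
    followers sigma j k = h :: followers sigma j h &
    forall i : 'I_n, (i < k)%N -> sigma i = j -> (i <= h)%N].
Proof.
pose P := fun i : 'I_n => (i < k)%N && (sigma i == j).
case: (pickP P) => [x Px|none].
  right; case: (@arg_maxnP _ x P val Px) => h /andP[hk /eqP hj] hmax.
  exists h; split=> // [|i ik ij]; last by apply: hmax; rewrite /P ik ij eqxx.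
  rewrite -hj -followersS; apply: eq_filter => i; rewrite hj.
  apply/andP/andP => -[ik ij]; split=> //; last exact: leq_trans ik hk.
  by apply: hmax; rewrite /P ik ij.
left; split=> [i ik ij|]; first by have := none i; rewrite /P ik ij eqxx.
by rewrite -(filter_pred0 [seq rev_ord l | l <- enum 'I_n]); apply: eq_filter.
Qed.

Lemma outcome_after_lt (lambda : profile n m) i (h : i.-tuple 'I_m) j (k : 'I_n) :
  (k < i)%N -> outcome_after lambda h j k = nth j h k.
Proof. by rewrite outcome_ofE => ->. Qed.

Lemma outcome_after_eq (lambda : profile n m) i (h : i.-tuple 'I_m) j :
  outcome_after lambda h j i = j.
Proof. by rewrite outcome_ofE ltnn eqxx. Qed.

(** Deviating to [j] after the realized history leaves all earlier choices in place, and the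
    reactions of later players do not enter the cost of [i]. *)
Lemma SPE_greedy (R : realType) (G : game R n m) (lambda : profile n m) i j :
  descending_order G -> SPE G lambda ->
  cost G (outcome_of lambda) i <=
    tour G (i :: followers (outcome_of lambda) j i).
Proof.
move=> desc spe; set sigma := outcome_of lambda.
have past j' (k : 'I_n) : (k < i)%N ->
    outcome_after lambda (history sigma i) j' k = sigma k.
  move=> ki; rewrite outcome_after_lt //.
  rewrite -[val k]/(val (Ordinal ki)) -tnth_nth tnth_mktuple.
  by congr (sigma _); apply: val_inj.
have := spe i (history sigma i) j; rewrite !cost_tour // !outcome_after_eq.
by rewrite -outcome_ofE !(eq_followers _ (past _)).
Qed.

End Followers.

(** * The two-cluster metric game *)

Section ClusterGame.
Context {R : realType} (n m : nat) (delta : R).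
Hypotheses (delta_gt0 : 0 < delta) (delta_le1 : delta <= 1).
Hypothesis m_gt1 : (1 < m)%N.

Definition cluster (i : 'I_n) : bool := odd (i %/ m).

(** The source lies at distance 0 from the destination. Both are at distance 1 from every player, so
    2 is the largest distance between players that the triangle inequality permits. *)
Definition cluster_dist (x y : vertex n) : R :=
  match x, y with
  | player i, player k =>
      if i == k then 0 else if cluster i == cluster k then delta else 2
  | player _, _ | _, player _ => 1
  | _, _ => 0
  end.

Lemma cluster_dist_ge0 x y : 0 <= cluster_dist x y.
Proof.
by case: x y => [i||] [k||] //=; do 2 (case: ifP => // _); exact: ltW.
Qed.

Lemma cluster_dist_sym x y : cluster_dist x y = cluster_dist y x.
Proof.
by case: x y => [i||] [k||] //=; rewrite [i == k]eq_sym [cluster i == _]eq_sym.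
Qed.

Lemma cluster_dist_xx x : cluster_dist x x = 0.
Proof. by case: x => [i||] //=; rewrite eqxx. Qed.

Definition cluster_game : game R n m :=
  Game (fun=> perm (@rev_ord_inj n))
    cluster_dist_ge0 cluster_dist_sym cluster_dist_xx.
Local Notation G := cluster_game.

Lemma cluster_game_metric : metric G.
Proof.
move: delta_gt0 delta_le1 => d0 d1.
case=> [i||] [k||] [l||] //=; try (repeat case: ifP => //; move=> *; lra).
have [->|ik] := eqVneq i k; first by rewrite add0r.
have [<-|kl] := eqVneq k l; first by rewrite (negbTE ik) addr0.
case: eqP => _; first by do 2 case: ifP => _; lra.
by case: (cluster i) (cluster k) (cluster l) => [] [] [] /=; lra.
Qed.

Lemma cluster_game_descending : descending_order G.
Proof. by move=> j k; rewrite permE. Qed.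

Lemma tour_cluster (i : 'I_n) (s : seq 'I_n) :
  {in s, forall k, cluster k = cluster i} ->
  tour G (i :: s) <= 1 + delta * (size s)%:R.
Proof.
elim: s i => [|k s IH] i same_cluster /=; first by rewrite mulr0 !addr0.
have ki : cluster k = cluster i by rewrite same_cluster ?mem_head.
have /IH : {in s, forall l, cluster l = cluster k}.
  by move=> l ls; rewrite ki same_cluster // inE ls orbT.
have : cluster_dist (player i) (player k) <= delta.
  by rewrite /= ki eqxx; case: ifP => // _; exact: ltW.
by rewrite /= -natr1; lra.
Qed.

(** Player 0 is always the last stop before t; this keeps the optimum positive. *)
Lemma cost_ge1 (sigma : outcome n m) (i : 'I_n) :
  i = 0%N :> nat -> 1 <= cost G sigma i.
Proof.
move=> i0; rewrite (cost_tour _ _ cluster_game_descending).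
have [[_ ->]|[h []]] := followersP sigma (sigma i) i; last by rewrite i0.
by rewrite /= addr0.
Qed.

(** * Equilibrium costs, group by group *)

Section Equilibrium.
Variable lambda : profile n m.
Hypothesis lambda_SPE : SPE G lambda.
Let sigma := outcome_of lambda.

(** The two halves need a joint induction: distinct buses let each earlier group fill all buses,
    which in turn determines the costs of the next group. *)
Definition cost_of_group (i : 'I_n) :=
  cost G sigma i = (i %/ m).*2.+1%:R /\
  forall k : 'I_n, (k < i)%N -> (k %/ m = i %/ m)%N -> sigma k <> sigma i.

Lemma SPE_cost_of_group (i : 'I_n) : cost_of_group i.
Proof.
have m_gt0 : (0 < m)%N by exact: ltnW.
have [b] := ubnP (val i); elim: b i => // b IHb i; rewrite ltnS => le_ib.
have {IHb le_ib} IH (k : 'I_n) : (k < i)%N -> cost_of_group k.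
  by move=> ki; apply: IHb; apply: leq_trans ki le_ib.
set g := (i %/ m)%N.
have le_gi : (g * m <= i)%N by exact: leq_divM.
(* Players of an earlier group ride pairwise distinct buses, hence fill all m. *)
have full a j : (a < g)%N ->
    exists k : 'I_n, [/\ (k < i)%N, (k %/ m = a)%N & sigma k = j].
  move=> ag.
  have lt_i (r : 'I_m) : (a * m + r < i)%N.
    apply: leq_trans le_gi; apply: leq_trans (_ : a.+1 * m <= _)%N.
      by rewrite mulSn addnC ltn_add2r.
    by rewrite leq_mul2r ag orbT.
  pose p r := Ordinal (ltn_trans (lt_i r) (ltn_ord i)).
  have pa r : (p r %/ m = a)%N by rewrite /= divnMDl // divn_small ?addn0.
  have inj : injective (sigma \o p).
    have distinct (r r' : 'I_m) : (r < r')%N -> sigma (p r) <> sigma (p r').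
      move=> rr'; apply: (proj2 (IH (p r') (lt_i r'))); rewrite ?pa //=.
      by rewrite ltn_add2l.
    move=> r r' /= e; apply: val_inj.
    by case: (ltngtP r r') => // /distinct; rewrite e.
  have [q _ qK] := injF_bij inj.
  by exists (p (q j)); split; [exact: lt_i|exact: pa|exact: (qK j)].
(* The next stop [h] on bus [j] is in group [g] or [g.-1], since the full group [g.-1] also rides on
   [j]. In group [g] she pays 2 g + 1 and [delta] is added; in group [g.-1] she pays 2 g - 1 and 2
   is added. *)
have joinE j :
    (forall k : 'I_n, (k < i)%N -> (k %/ m = g)%N -> sigma k <> j) /\
      tour G (i :: followers sigma j i) = g.*2.+1%:R \/
    (exists k : 'I_n, [/\ (k < i)%N, (k %/ m = g)%N & sigma k = j]) /\
      g.*2.+1%:R < tour G (i :: followers sigma j i).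
  have [[none ->]|[h [hi hj -> hmax]]] := followersP sigma j i.
    left; split=> [k ki _|]; first exact: none.
    (* For positive [g], group 0 already fills every bus, so none is empty. *)
    suff -> : g = 0%N by rewrite /= addr0.
    case: (posnP g) => // /(full _ j)[k [ki _ kj]].
    by case: (none k ki).
  have hg : (h %/ m <= g)%N by rewrite leq_div2r // ltnW.
  have -> : tour G (i :: h :: followers sigma j h) =
      cluster_dist (player i) (player h) + (h %/ m).*2.+1%:R.
    by rewrite -(IH h hi).1 (cost_tour _ _ cluster_game_descending) hj.
  have -> : cluster_dist (player i) (player h) =
      if odd g == odd (h %/ m) then delta else 2.
    by rewrite /= -val_eqE gtn_eqF.
  have [eq_hg|ne_hg] := eqVneq (h %/ m)%N g.
    by right; split; [exists h|rewrite eq_hg eqxx ltrDr].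
  have {ne_hg} lt_hg : (h %/ m < g)%N by rewrite ltn_neqAle ne_hg.
  have g_gt0 : (0 < g)%N by apply: leq_ltn_trans lt_hg.
  have [k [ki kg kj]] : exists k : 'I_n,
    [/\ (k < i)%N, (k %/ m = g.-1)%N & sigma k = j].
    by apply: full; rewrite ltn_predL.
  have kh : (g.-1 <= h %/ m)%N by rewrite -kg leq_div2r // hmax.
  left; split=> [l li lg lj|].
    have : (l %/ m <= h %/ m)%N by rewrite leq_div2r // hmax.
    by rewrite lg leqNgt lt_hg.
  have -> : g = (h %/ m).+1.
    by apply/eqP; rewrite eqn_leq lt_hg andbT -(prednK g_gt0) ltnS.
  rewrite doubleS /=; case: (odd _) => /=; rewrite -!natr1; lra.
(* Pigeonhole: the members of the group before [i] have remainders below [i %% m], hence there are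
   fewer than [m] of them. *)
have [j free] : exists j, forall k : 'I_n,
    (k < i)%N -> (k %/ m = g)%N -> sigma k <> j.
  apply: contrapT => /forallNP taken.
  have /choice[f fP] : forall j, exists k : 'I_n,
      [/\ (k < i)%N, (k %/ m = g)%N & sigma k = j].
    move=> j; apply: contrapT => /forallNP H; apply: (taken j) => k ki kg kj.
    by apply: (H k); split.
  have lt_r j : (f j %% m < i %% m)%N.
    have [lt_fi fg _] := fP j.
    by move: lt_fi; rewrite {1}(divn_eq (f j) m) {1}(divn_eq i m) fg ltn_add2l.
  have inj : injective (fun j => Ordinal (lt_r j)).
    move=> j j' [e]; have [_ fg <-] := fP j; have [_ fg' <-] := fP j'.
    congr (sigma _); apply: val_inj => /=.
    by rewrite (divn_eq (f j) m) (divn_eq (f j') m) e fg fg'.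
  have := leq_card _ inj; rewrite !card_ord leqNgt.
  by rewrite ltn_mod m_gt0.
have greedy := SPE_greedy i j cluster_game_descending lambda_SPE.
have costE := cost_tour sigma i cluster_game_descending.
have le_cost : cost G sigma i <= g.*2.+1%:R.
  by case: (joinE j) => [[_ <-]|[[k [ki kg kj]]]]; last case: (free k ki kg kj).
(* The free bus caps her cost at 2 g + 1, so her own bus cannot carry an earlier member of her
   group. *)
case: (joinE (sigma i)); rewrite -costE => -[]; last by rewrite ltNge le_cost.
by move=> distinct cost_i; split.
Qed.

End Equilibrium.
End ClusterGame.

(** * Bounds on the optimum and the resulting ratio *)

Lemma cost_le_egalitarian (R : realType) (n m : nat) (G : game R n m)
  (sigma : outcome n m) (i : 'I_n) : cost G sigma i <= egalitarian G sigma.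
Proof. exact: (le_bigmax_cond 0 (fun i => cost G sigma i)). Qed.

Section ClusterGameSPoS.
Context {R : realType} (n m : nat) (delta : R).
Hypotheses (delta_gt0 : 0 < delta) (delta_le1 : delta <= 1).
Hypotheses (n_gt0 : (0 < n)%N) (m_gt1 : (1 < m)%N).
Local Notation G := (cluster_game n m delta_gt0).
Local Notation E := (@egalitarian R n m).

Lemma cluster_optimum_ge1 : 1 <= optimum E G.
Proof.
have [sigma -> _] := optimum_attained E G (ltnW m_gt1).
by apply: le_trans (cost_le_egalitarian G sigma (Ordinal n_gt0)); exact: cost_ge1.
Qed.

Lemma cluster_optimum_le : optimum E G <= 1 + delta * n%:R.
Proof.
have [sigma -> min_sigma] := optimum_attained E G (ltnW m_gt1).
pose bus (b : bool) : 'I_m := if b then Ordinal m_gt1 else Ordinal (ltnW m_gt1).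
have bus_inj : injective bus by case=> [] [].
pose tau : outcome n m := [ffun i => bus (cluster m i)].
apply: le_trans (min_sigma tau) _; have d0 := ltW delta_gt0.
apply: bigmax_le => [|i _]; first by rewrite addr_ge0 ?mulr_ge0.
rewrite (cost_tour _ _ (cluster_game_descending delta_gt0)).
apply: le_trans (tour_cluster delta_gt0 _) _.
  by move=> k; rewrite mem_filter !ffunE => /andP[/andP[_ /eqP/bus_inj]].
by rewrite lerD2l ler_wpM2l // ler_nat size_followers.
Qed.

(** The infimum [SPoS] is attained at some SPE and the optimum is positive, so a bound for each SPE
    passes to the supremum over the class. *)
Lemma cluster_SPoS_ge (r : R) :
  (forall lambda, SPE G lambda -> r * optimum E G <= E G (outcome_of lambda)) ->
  (r%:E <= SPoS_class E [set H | metric H /\ same_permutation H]%classic)%E.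
Proof.
move=> bound; have opt_gt0 := lt_le_trans ltr01 cluster_optimum_ge1.
apply: (@le_trans _ _ (SPoS E G)%:E).
  have [lambda spe ->] := SPoS_attained E G (ltnW m_gt1).
  by rewrite lee_fin ler_pdivlMr // bound.
apply: ereal_sup_ubound; exists G => //; split=> //; split=> //.
exact: cluster_game_metric.
Qed.

End ClusterGameSPoS.

Theorem proposition3p4 (R : realType) (n m : nat)
    (hn : (1 <= n)%N) (hm : (2 <= m)%N) :
  (((n %/ m)%N%:R : R)%:E
     <= SPoS_class (@egalitarian R n m)
          [set G | metric G /\ same_permutation G]%classic)%E.
Proof.
set q := (n %/ m)%N.
have n1 : 1 <= n%:R :> R by rewrite ler1n.
pose delta : R := (2 * n%:R)^-1.
have delta_gt0 : 0 < delta by rewrite invr_gt0; lra.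
have delta_le1 : delta <= 1 by rewrite invf_le1; lra.
have delta_n : delta * n%:R = 2^-1.
  by rewrite /delta invfM -mulrA mulVf ?mulr1 // gt_eqF // (lt_le_trans ltr01).
apply: (cluster_SPoS_ge delta_le1 hn hm (delta_gt0 := delta_gt0)) => lambda spe.
have opt_ge1 := cluster_optimum_ge1 delta_gt0 hn hm.
have := cluster_optimum_le n delta_gt0 hm; rewrite delta_n => opt_le.
have [q_le1|q_gt1] := leqP q 1.
  apply: (@le_trans _ _ (optimum (@egalitarian R n m)
    (cluster_game n m delta_gt0))).
    by rewrite ler_piMl ?lern1 // (le_trans ler01).
  have [sigma -> min_sigma] := optimum_attained (@egalitarian R n m)
    (cluster_game n m delta_gt0) (ltnW hm).
  exact: min_sigma.
(* The witness is the first player of group [q.-1], the last group with all [m] members; she pays 2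
   (q - 1) + 1. *)
have lt_n : (q.-1 * m < n)%N.
  apply: leq_trans (leq_divM n m).
  by rewrite ltn_pmul2r ?(ltnW hm) // ltn_predL ltnW.
apply: le_trans (cost_le_egalitarian _ _ (Ordinal lt_n)).
have [-> _] := SPE_cost_of_group hm spe (Ordinal lt_n).
rewrite /= mulnK ?(ltnW hm) //.
have q2 : 2 <= q%:R :> R by rewrite (ler_nat _ 2).
have -> : (q.-1.*2.+1)%:R = 2 * q%:R - 1 :> R.
  rewrite -[in RHS](prednK (ltnW q_gt1)) -!natr1 -muln2 natrM; lra.
(* The inequality 3 q / 2 <= 2 q - 1 is exactly q >= 2. *)
apply: (@le_trans _ _ (q%:R * (1 + 2^-1))); last by lra.
by rewrite ler_wpM2l.
Qed.
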